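(* There exist absolute constants $c>0$ and $C>0$ such that the following holds. Let $n\ge 2$ be an integer and let $L,\mu,\Delta,\varepsilon>0$ satisfy $\kappa:=L/\mu\ge n/2+1$ and $\varepsilon/\Delta\le 0.00327$. Then for every PIFO algorithm $\mathcal{A}$ there exist a dimension $d\le C\sqrt{\kappa/n}\,\log(\Delta/\varepsilon)$ and $n$ functions $f_1,\dots,f_n:\mathbb{R}^d\to\mathbb{R}$, each $L$-smooth and $\mu$-strongly convex, such that $f=\frac1n\sum_{i=1}^n f_i$ satisfies $f(x_0)-f(x^* )=\Delta$ (where $x^*$ is the minimizer of $f$ and $x_0$ the initial point of $\mathcal{A}$), and the iterates of $\mathcal{A}$ run on $f_1,\dots,f_n$ satisfy $\mathbb{E} f(x_t)-f(x^* )\ge\varepsilon$ for all integers $0\le t\le c\,(n+\sqrt{\kappa n})\log(\Delta/\varepsilon)$. In other words, $\mathcal{A}$ needs $\Omega\big((n+\sqrt{\kappa n})\log(\Delta/\varepsilon)\big)$ oracle queries to find $\hat x$ with $\mathbb{E} f(\hat x)-f(x^* )<\varepsilon$.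
   Context: A differentiable $g:\mathbb{R}^d\to\mathbb{R}$ is $L$-smooth if $\|\nabla g(x)-\nabla g(y)\|_2\le L\|x-y\|_2$ for all $x,y$, and $\mu$-strongly convex if $g(y)\ge g(x)+\langle\nabla g(x),y-x\rangle+\frac{\mu}{2}\|y-x\|_2^2$ for all $x,y$. For $\gamma>0$, $\mathrm{prox}^{\gamma}_g(x)=\arg\min_u\{g(u)+\frac{1}{2\gamma}\|x-u\|_2^2\}$. PIFO algorithm: given $f_1,\dots,f_n:\mathbb{R}^d\to\mathbb{R}$ and $f=\frac1n\sum_i f_i$, a PIFO algorithm $\mathcal{A}$ is specified by a probability vector $(p_1,\dots,p_n)$ ($p_j\ge0$, $\sum_j p_j=1$), an initial point $x_0$ and parameters $\gamma_t>0$; it draws indices $i_1,i_2,\dots$ independently with $\mathbb{P}(i_t=j)=p_j$, at step $t\ge1$ queries the oracle $h_f(x_{t-1},i_t,\gamma_t)=[f_{i_t}(x_{t-1}),\nabla f_{i_t}(x_{t-1}),\mathrm{prox}^{\gamma_t}_{f_{i_t}}(x_{t-1})]$, and outputs an iterate $x_t\in\mathrm{span}\{x_0,\dots,x_{t-1},\nabla f_{i_1}(x_0),\dots,\nabla f_{i_t}(x_{t-1}),\mathrm{prox}^{\gamma_1}_{f_{i_1}}(x_0),\dots,\mathrm{prox}^{\gamma_t}_{f_{i_t}}(x_{t-1})\}$ (the choice within the span may depend on all previously observed information). Iterate $x_t$ uses $t$ oracle queries. *)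

(* Defs.v *)
From Stdlib Require Import Reals List.
From Stdlib Require Fin.
Import ListNotations.
Open Scope R_scope.

Fixpoint fsum (d : nat) : (Fin.t d -> R) -> R :=
  match d return (Fin.t d -> R) -> R with
  | O => fun _ => 0
  | S d' => fun f => f Fin.F1 + fsum d' (fun i => f (Fin.FS i))
  end.

Definition Vec (d : nat) : Type := Fin.t d -> R.

Definition vzero {d} : Vec d := fun _ => 0.
Definition vadd {d} (x y : Vec d) : Vec d := fun i => x i + y i.
Definition vsub {d} (x y : Vec d) : Vec d := fun i => x i - y i.
Definition vscale {d} (a : R) (x : Vec d) : Vec d := fun i => a * x i.

Definition dot {d} (x y : Vec d) : R := fsum d (fun i => x i * y i).
Definition sqnorm {d} (x : Vec d) : R := dot x x.
Definition norm {d} (x : Vec d) : R := sqrt (sqnorm x).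

Definition has_gradient {d} (g : Vec d -> R) (x v : Vec d) : Prop :=
  forall eps, 0 < eps -> exists delta, 0 < delta /\
    forall y, norm (vsub y x) < delta ->
      Rabs (g y - g x - dot v (vsub y x)) <= eps * norm (vsub y x).

Definition is_gradient {d} (g : Vec d -> R) (gg : Vec d -> Vec d) : Prop :=
  forall x, has_gradient g x (gg x).

(* L-smoothness of g, whose gradient is gg *)
Definition L_smooth {d} (L : R) (gg : Vec d -> Vec d) : Prop :=
  forall x y, norm (vsub (gg x) (gg y)) <= L * norm (vsub x y).

Definition strongly_convex {d} (mu : R) (g : Vec d -> R) (gg : Vec d -> Vec d) : Prop :=
  forall x y, g y >= g x + dot (gg x) (vsub y x) + mu / 2 * sqnorm (vsub y x).

Definition is_prox {d} (g : Vec d -> R) (gamma : R) (x u : Vec d) : Prop :=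
  forall v, g u + / (2 * gamma) * sqnorm (vsub x u)
            <= g v + / (2 * gamma) * sqnorm (vsub x v).

Fixpoint lincomb {d} (cs : list R) (vs : list (Vec d)) : Vec d :=
  match cs, vs with
  | c :: cs', v :: vs' => vadd (vscale c v) (lincomb cs' vs')
  | _, _ => vzero
  end.

Definition in_span {d} (vs : list (Vec d)) (v : Vec d) : Prop :=
  exists cs, v = lincomb cs vs.

(* One oracle round: query point x_{t-1}, drawn index i_t, and the answer
   [f_{i_t}(x_{t-1}), grad f_{i_t}(x_{t-1}), prox^{gamma_t}_{f_{i_t}}(x_{t-1})]. *)
Record obs (n d : nat) := Obs {
  o_pt : Vec d;
  o_idx : Fin.t n;
  o_val : R;
  o_grad : Vec d;
  o_prox : Vec d }.
Arguments o_pt {n d}.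
Arguments o_idx {n d}.
Arguments o_val {n d}.
Arguments o_grad {n d}.
Arguments o_prox {n d}.
Arguments Obs {n d}.

(* A PIFO algorithm for n component functions (indices Fin.t n): sampling
   distribution p, proximal parameters gamma_t (t >= 1), initial point in
   every dimension d, and an update rule choosing x_t from the whole observed
   history (all previous queries and oracle answers). *)
Record PIFO (n : nat) := MkPIFO {
  pifo_p : Fin.t n -> R;
  pifo_gamma : nat -> R;
  pifo_x0 : forall d, Vec d;
  pifo_step : forall d, list (obs n d) -> Vec d }.
Arguments pifo_p {n}.
Arguments pifo_gamma {n}.
Arguments pifo_x0 {n}.
Arguments pifo_step {n}.

Definition hist_vectors {n d} (x0 : Vec d) (h : list (obs n d)) : list (Vec d) :=
  x0 :: flat_map (fun o => [o_pt o; o_grad o; o_prox o]) h.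

Definition is_PIFO {n} (A : PIFO n) : Prop :=
  (forall j, 0 <= pifo_p A j) /\ fsum n (pifo_p A) = 1 /\
  (forall t, (1 <= t)%nat -> 0 < pifo_gamma A t) /\
  (forall d (h : list (obs n d)), h <> [] ->
     in_span (hist_vectors (pifo_x0 A d) h) (pifo_step A d h)).

Definition cur_iterate {n d} (A : PIFO n) (h : list (obs n d)) : Vec d :=
  match h with
  | [] => pifo_x0 A d
  | _ => pifo_step A d h
  end.

Fixpoint run {n d} (A : PIFO n) (fs : Fin.t n -> Vec d -> R)
    (gfs : Fin.t n -> Vec d -> Vec d) (prx : Fin.t n -> R -> Vec d -> Vec d)
    (h : list (obs n d)) (s : list (Fin.t n)) : list (obs n d) :=
  match s with
  | [] => h
  | j :: s' =>
      let x := cur_iterate A h in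
      let g := pifo_gamma A (S (length h)) in
      run A fs gfs prx (h ++ [Obs x j (fs j x) (gfs j x) (prx j g x)]) s'
  end.

Definition iterate {n d} (A : PIFO n) fs gfs prx (s : list (Fin.t n)) : Vec d :=
  cur_iterate A (@run n d A fs gfs prx [] s).

(* Expectation over i_1, ..., i_t drawn i.i.d. from p of F(i_1, ..., i_t) *)
Fixpoint expect {n} (p : Fin.t n -> R) (t : nat) (F : list (Fin.t n) -> R) : R :=
  match t with
  | O => F []
  | S t' => fsum n (fun j => p j * expect p t' (fun s => F (j :: s)))
  end.

Definition favg {n d} (fs : Fin.t n -> Vec d -> R) (x : Vec d) : R :=
  / INR n * fsum n (fun j => fs j x).

(* Main.v *)
Require Import Defs.
From Stdlib Require Import Reals ZArith List Lra Lia FunctionalExtensionality.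
From Stdlib Require Fin.
Import ListNotations.
Open Scope R_scope.

(** Pick two indices [a <> b] that are drawn with probability at most [2 / n].  Besides the term
[mu / 2 * |y - z * e_0|^2] common to all components, component [a] carries the links [y_k - y_(k+1)]
of a chain with [k] even together with a linear term driving [y_1], component [b] carries the links
with [k] odd, and the others carry nothing.  The links inside one component are disjoint, so its
Hessian is [mu] plus a matching Laplacian: it is [L]-smooth, and a gradient or a prox extends the
support of a point by at most one coordinate, and only if the component holding the next link is
drawn.  The average has condition number of order [kappa / n], and its minimizer is exactly
geometric, [y*_k = B * r^k] with [1 - r] of order [sqrt (n / kappa)].  Hence a point supported on
the first [k] coordinates has gap at least [Delta / 2 * (r^(2k) - r^(2m))], and the expectation of
[r^(2k)] shrinks at most by the factor [1 - 2 / n * (1 - r^2)] per query.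

The span always contains [x0], so coordinate 0 is reserved for the direction of [x0], by means of a
Householder reflection; the chain lives on the coordinates [1, ..., m]. *)

(** * Real inequalities *)

Lemma pow_antitone x k l : 0 <= x <= 1 -> (k <= l)%nat -> x ^ l <= x ^ k.
Proof.
  intros Hx Hkl; replace l with (k + (l - k))%nat by lia; rewrite pow_add.
  assert (0 <= x ^ k) by (apply pow_le, Hx).
  assert (x ^ (l - k) <= 1) by (rewrite <- (pow1 (l - k)); apply pow_incr, Hx); nra.
Qed.

Lemma two_div_bounds x : 2 <= x -> 0 < 2 / x <= 1.
Proof.
  intros Hx; split; [apply Rdiv_lt_0_compat; lra|].
  apply (Rmult_le_reg_r x); [lra|]; unfold Rdiv; rewrite Rmult_assoc, Rinv_l; lra.
Qed.

Lemma pow_exp x t : exp x ^ t = exp (INR t * x).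
Proof. rewrite <- Rpower_pow by apply exp_pos; unfold Rpower; rewrite ln_exp; reflexivity. Qed.

Lemma exp_le x y : x <= y -> exp x <= exp y.
Proof. intros [H| ->]; [left; apply exp_increasing, H|right; reflexivity]. Qed.

Lemma pow_le_exp x t : 0 <= x -> x ^ t <= exp (- (INR t * (1 - x))).
Proof.
  intros Hx; replace (- (INR t * (1 - x))) with (INR t * (x - 1)) by ring.
  rewrite <- pow_exp; apply pow_incr; pose proof (exp_ineq1_le (x - 1)); lra.
Qed.

Lemma pow_ge_exp x t : 0 <= x < 1 -> exp (- (INR t * (x / (1 - x)))) <= (1 - x) ^ t.
Proof.
  intros Hx; replace (- (INR t * (x / (1 - x)))) with (INR t * - (x / (1 - x))) by ring.
  rewrite <- pow_exp; apply pow_incr; split; [left; apply exp_pos|].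
  assert (0 <= x / (1 - x)) by (apply Rmult_le_pos; [|left; apply Rinv_0_lt_compat]; lra).
  rewrite exp_Ropp; apply Rle_trans with (/ (1 + x / (1 - x))); [|right; field; lra].
  apply Rinv_le_contravar; [lra|apply exp_ineq1_le].
Qed.

Lemma exists_nat_ceil x : 0 < x -> exists k : nat, (1 <= k)%nat /\ x <= INR k <= x + 1.
Proof.
  intros Hx; destruct (archimed x) as [Hup_gt Hup_le].
  assert (Hpos : (0 < up x)%Z) by (apply lt_IZR; lra).
  exists (Z.to_nat (up x)); rewrite INR_IZR_INZ, Z2Nat.id by lia; split; [lia|lra].
Qed.

Lemma sqrt_mult_div x y : 0 <= x -> 0 < y -> sqrt (x * y) = y * sqrt (x / y).
Proof.
  intros Hx Hy; rewrite <- (sqrt_square y) at 2 by lra; rewrite <- sqrt_mult_alt by nra.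
  f_equal; field; lra.
Qed.

(** * Finite sums *)

Lemma fsum_ext d (f g : Fin.t d -> R) : (forall i, f i = g i) -> fsum d f = fsum d g.
Proof.
  intros E; induction d as [|d IH]; simpl; [reflexivity|].
  rewrite E; f_equal; apply IH; intros i; apply E.
Qed.

Lemma fsum_le d (f g : Fin.t d -> R) : (forall i, f i <= g i) -> fsum d f <= fsum d g.
Proof.
  intros E; induction d as [|d IH]; simpl; [lra|].
  apply Rplus_le_compat; [apply E|apply IH; intros i; apply E].
Qed.

Lemma fsum_plus d (f g : Fin.t d -> R) : fsum d (fun i => f i + g i) = fsum d f + fsum d g.
Proof. induction d as [|d IH]; simpl; [lra|]. rewrite IH; lra. Qed.

Lemma fsum_scal d a (f : Fin.t d -> R) : fsum d (fun i => a * f i) = a * fsum d f.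
Proof. induction d as [|d IH]; simpl; [lra|]. rewrite IH; lra. Qed.

Lemma fsum_minus d (f g : Fin.t d -> R) : fsum d (fun i => f i - g i) = fsum d f - fsum d g.
Proof. induction d as [|d IH]; simpl; [lra|]. rewrite IH; lra. Qed.

Lemma fsum_const d a : fsum d (fun _ => a) = INR d * a.
Proof.
  induction d as [|d IH]; [simpl; lra|].
  rewrite S_INR; simpl fsum; rewrite IH; lra.
Qed.

Lemma fsum_0 d : fsum d (fun _ => 0) = 0.
Proof. rewrite fsum_const; ring. Qed.

Lemma fsum_nonneg d (f : Fin.t d -> R) : (forall i, 0 <= f i) -> 0 <= fsum d f.
Proof. intros Hf; rewrite <- (fsum_0 d); apply fsum_le, Hf. Qed.

Lemma fsum_exchange n d (f : Fin.t n -> Fin.t d -> R) :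
  fsum n (fun i => fsum d (f i)) = fsum d (fun j => fsum n (fun i => f i j)).
Proof.
  induction n as [|n IH]; simpl.
  - rewrite fsum_0; reflexivity.
  - rewrite IH, fsum_plus; reflexivity.
Qed.

Lemma fsum_indicator d (a : Fin.t d) c :
  fsum d (fun i => if Fin.eq_dec i a then c else 0) = c.
Proof.
  induction a as [d|d a IH]; cbn [fsum].
  - destruct (Fin.eq_dec Fin.F1 Fin.F1) as [_|H]; [|easy].
    rewrite (fsum_ext _ _ (fun _ => 0)), fsum_0; [ring|].
    intros i; destruct (Fin.eq_dec (Fin.FS i) Fin.F1) as [H|_]; [inversion H|reflexivity].
  - destruct (Fin.eq_dec Fin.F1 (Fin.FS a)) as [H|_]; [inversion H|].
    rewrite Rplus_0_l, <- IH at 1; apply fsum_ext; intros i.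
    destruct (Fin.eq_dec (Fin.FS i) (Fin.FS a)) as [ES|ES], (Fin.eq_dec i a) as [E|E];
      [reflexivity|apply Fin.FS_inj in ES; contradiction|congruence|reflexivity].
Qed.

Lemma fsum_involution d (pi : Fin.t d -> Fin.t d) (f : Fin.t d -> R) :
  (forall i, pi (pi i) = i) -> fsum d (fun i => f (pi i)) = fsum d f.
Proof.
  intros Hpi.
  transitivity (fsum d (fun i => fsum d (fun j => if Fin.eq_dec j (pi i) then f (pi i) else 0))).
  { apply fsum_ext; intros i; symmetry; apply fsum_indicator. }
  rewrite fsum_exchange; apply fsum_ext; intros j.
  rewrite <- (fsum_indicator d (pi j) (f j)); apply fsum_ext; intros i.
  destruct (Fin.eq_dec j (pi i)) as [Ej|Ej], (Fin.eq_dec i (pi j)) as [Ei|Ei]; congruence.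
Qed.

Lemma exists_le_mean n (p : Fin.t (S n) -> R) : exists a, INR (S n) * p a <= fsum (S n) p.
Proof.
  induction n as [|n IH]; [exists Fin.F1; simpl; lra|].
  destruct (IH (fun i => p (Fin.FS i))) as [a Ha]; cbn [fsum] in *; rewrite S_INR.
  pose proof (pos_INR (S n)).
  destruct (Rle_lt_dec (p Fin.F1) (p (Fin.FS a))); [exists Fin.F1|exists (Fin.FS a)]; nra.
Qed.

Lemma exists_ne_le_mean n (p : Fin.t (S (S n)) -> R) a :
  exists b, b <> a /\ INR (S n) * p b <= fsum (S (S n)) p - p a.
Proof.
  revert p a; induction n as [|n IH]; intros p a; apply (Fin.caseS' a); clear a.
  - exists (Fin.FS Fin.F1); split; [discriminate|simpl; lra].
  - intros a; exists Fin.F1; split; [discriminate|].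
    apply (Fin.caseS' a); [simpl; lra|intros i; inversion i].
  - destruct (exists_le_mean (S n) (fun i => p (Fin.FS i))) as [b Hb].
    exists (Fin.FS b); split; [discriminate|cbn [fsum] in *; lra].
  - intros a; destruct (IH (fun i => p (Fin.FS i)) a) as (b & Hba & Hb).
    cbn [fsum] in *; rewrite S_INR; pose proof (pos_INR (S n)).
    destruct (Rle_lt_dec (p Fin.F1) (p (Fin.FS b)));
      [exists Fin.F1; split; [discriminate|nra]|exists (Fin.FS b); split; [|nra]].
    intros E; apply Fin.FS_inj in E; contradiction.
Qed.

Lemma exists_two_unlikely n (p : Fin.t n -> R) :
  (2 <= n)%nat -> (forall i, 0 <= p i) -> fsum n p = 1 ->
  exists a b, a <> b /\ p a <= 2 / INR n /\ p b <= 2 / INR n.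
Proof.
  intros Hn Hp Hsum; destruct n as [|[|n]]; [lia..|].
  assert (Hle : forall x y, 0 <= y -> INR (S n) * x <= 1 - y -> x <= 2 / INR (S (S n))).
  { intros x y Hy Hx; apply (Rmult_le_reg_l (INR (S (S n)))); [apply lt_0_INR; lia|].
    replace (INR (S (S n)) * (2 / INR (S (S n)))) with 2 by (field; apply not_0_INR; lia).
    rewrite !S_INR in *; pose proof (pos_INR n); nra. }
  destruct (exists_ne_le_mean n p Fin.F1) as (a & _ & Ha).
  destruct (exists_ne_le_mean n p a) as (b & Hba & Hb).
  rewrite Hsum in Ha, Hb.
  exists a, b; split; [congruence|split; eapply Hle; eauto].
Qed.

(** * Euclidean geometry *)

Lemma dot_comm {d} (x y : Vec d) : dot x y = dot y x.
Proof. apply fsum_ext; intros i; ring. Qed.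

Lemma dot_add_r {d} (x y z : Vec d) : dot x (vadd y z) = dot x y + dot x z.
Proof. unfold dot; rewrite <- fsum_plus; apply fsum_ext; intros i; unfold vadd; ring. Qed.

Lemma dot_scale_r {d} a (x y : Vec d) : dot x (vscale a y) = a * dot x y.
Proof. unfold dot; rewrite <- fsum_scal; apply fsum_ext; intros i; unfold vscale; ring. Qed.

Lemma dot_sub_r {d} (x y z : Vec d) : dot x (vsub y z) = dot x y - dot x z.
Proof. unfold dot; rewrite <- fsum_minus; apply fsum_ext; intros i; unfold vsub; ring. Qed.

Lemma dot_add_l {d} (x y z : Vec d) : dot (vadd y z) x = dot y x + dot z x.
Proof. rewrite !(dot_comm _ x); apply dot_add_r. Qed.

Lemma dot_scale_l {d} a (x y : Vec d) : dot (vscale a y) x = a * dot y x.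
Proof. rewrite !(dot_comm _ x); apply dot_scale_r. Qed.

Lemma dot_sub_l {d} (x y z : Vec d) : dot (vsub y z) x = dot y x - dot z x.
Proof. rewrite !(dot_comm _ x); apply dot_sub_r. Qed.

Lemma dot_zero_l {d} (x : Vec d) : dot vzero x = 0.
Proof. rewrite <- (fsum_0 d); apply fsum_ext; intros i; unfold vzero; ring. Qed.

Lemma sqnorm_ge0 {d} (x : Vec d) : 0 <= sqnorm x.
Proof. apply fsum_nonneg; intros i; nra. Qed.

Lemma sqnorm_add {d} (x y : Vec d) : sqnorm (vadd x y) = sqnorm x + 2 * dot x y + sqnorm y.
Proof. unfold sqnorm; rewrite !dot_add_l, !dot_add_r, (dot_comm y x); ring. Qed.

Lemma sqnorm_sub {d} (x y : Vec d) : sqnorm (vsub x y) = sqnorm x - 2 * dot x y + sqnorm y.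
Proof. unfold sqnorm; rewrite !dot_sub_l, !dot_sub_r, (dot_comm y x); ring. Qed.

Lemma sqnorm_scale {d} a (x : Vec d) : sqnorm (vscale a x) = a * a * sqnorm x.
Proof. unfold sqnorm; rewrite dot_scale_l, dot_scale_r; ring. Qed.

Lemma sqnorm_eq0 {d} (x : Vec d) : sqnorm x = 0 -> x = vzero.
Proof.
  intros H; apply functional_extensionality; intros i; unfold vzero.
  revert x H; induction i as [d|d i IH]; intros x H;
    pose proof (sqnorm_ge0 (fun j => x (Fin.FS j))) as Htail;
    unfold sqnorm, dot in *; cbn [fsum] in H.
  - nra.
  - apply (IH (fun j => x (Fin.FS j))); nra.
Qed.

Lemma norm_ge0 {d} (x : Vec d) : 0 <= norm x.
Proof. apply sqrt_pos. Qed.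

Lemma norm_sqr {d} (x : Vec d) : norm x * norm x = sqnorm x.
Proof. apply sqrt_sqrt, sqnorm_ge0. Qed.

Lemma norm_le_of_sqnorm_le {d} (x y : Vec d) a :
  0 <= a -> sqnorm x <= a * a * sqnorm y -> norm x <= a * norm y.
Proof.
  intros Ha H; pose proof (norm_ge0 y) as Hy.
  rewrite <- (sqrt_square (a * norm y)) by nra; apply sqrt_le_1_alt.
  replace (a * norm y * (a * norm y)) with (a * a * (norm y * norm y)) by ring.
  rewrite norm_sqr; exact H.
Qed.

Lemma dot_inj {d} (x y : Vec d) : (forall h, dot x h = dot y h) -> x = y.
Proof.
  intros E; apply functional_extensionality; intros i.
  assert (H : vsub x y = vzero) by (apply sqnorm_eq0; unfold sqnorm; rewrite dot_sub_l, E; ring).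
  apply (f_equal (fun v => v i)) in H; unfold vsub, vzero in H; lra.
Qed.

Definition subspace {d} (W : Vec d -> Prop) : Prop :=
  W vzero /\ (forall x y, W x -> W y -> W (vadd x y)) /\ (forall a x, W x -> W (vscale a x)).

Lemma in_span_subspace d (W : Vec d -> Prop) vs v :
  subspace W -> Forall W vs -> in_span vs v -> W v.
Proof.
  intros (W0 & Wadd & Wscale) Hvs [cs ->]; revert cs.
  induction Hvs as [|u vs Hu _ IH]; intros [|c cs]; simpl; auto.
Qed.

(** * Symmetric maps and reflections *)

Definition symmetric {d} (M : Vec d -> Vec d) : Prop :=
  forall x y, dot (M x) y = dot x (M y).

Section SymmetricMap.

Context {d : nat} {M : Vec d -> Vec d}.
Hypothesis Msym : symmetric M.

Lemma symmetric_zero : M vzero = vzero.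
Proof. apply dot_inj; intros h; rewrite Msym, !dot_zero_l; reflexivity. Qed.

Lemma symmetric_add x y : M (vadd x y) = vadd (M x) (M y).
Proof. apply dot_inj; intros h; rewrite Msym, !dot_add_l, !Msym; reflexivity. Qed.

Lemma symmetric_sub x y : M (vsub x y) = vsub (M x) (M y).
Proof. apply dot_inj; intros h; rewrite Msym, !dot_sub_l, !Msym; reflexivity. Qed.

Lemma symmetric_scale a x : M (vscale a x) = vscale a (M x).
Proof. apply dot_inj; intros h; rewrite Msym, !dot_scale_l, !Msym; reflexivity. Qed.

Lemma subspace_preimage W : subspace W -> subspace (fun x => W (M x)).
Proof.
  intros (W0 & Wadd & Wscale); repeat split.
  - rewrite symmetric_zero; exact W0.
  - intros x y Hx Hy; rewrite symmetric_add; auto.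
  - intros a x Hx; rewrite symmetric_scale; auto.
Qed.

End SymmetricMap.

Definition reflection {d} (H : Vec d -> Vec d) : Prop :=
  symmetric H /\ forall x, H (H x) = x.

Lemma reflection_sqnorm {d} (H : Vec d -> Vec d) x : reflection H -> sqnorm (H x) = sqnorm x.
Proof. intros [Hsym Hinv]; unfold sqnorm; rewrite Hsym, Hinv; reflexivity. Qed.

Lemma reflection_norm {d} (H : Vec d -> Vec d) x : reflection H -> norm (H x) = norm x.
Proof. intros HH; unfold norm; rewrite reflection_sqnorm by exact HH; reflexivity. Qed.

(* A reflection also for [v = 0], whatever the value of [/ 0]. *)
Definition householder {d} (v x : Vec d) : Vec d := vsub x (vscale (2 * dot v x / sqnorm v) v).

Lemma householder_reflection {d} (v : Vec d) : reflection (householder v).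
Proof.
  unfold householder; split; intros x.
  - intros y; rewrite dot_sub_l, dot_sub_r, dot_scale_l, dot_scale_r.
    rewrite (dot_comm x v); unfold Rdiv; ring.
  - rewrite dot_sub_r, dot_scale_r; fold (sqnorm v).
    apply functional_extensionality; intros i; unfold vsub, vscale.
    destruct (Req_dec (sqnorm v) 0) as [E|E]; [|field; exact E].
    rewrite (sqnorm_eq0 v E); unfold vzero; ring.
Qed.

Lemma householder_swap {d} (x y : Vec d) : sqnorm x = sqnorm y -> householder (vsub x y) x = y.
Proof.
  intros E; unfold householder; apply functional_extensionality; intros i.
  destruct (Req_dec (sqnorm (vsub x y)) 0) as [E0|E0].
  - apply sqnorm_eq0 in E0; rewrite E0.
    apply (f_equal (fun v => v i)) in E0; unfold vsub, vscale, vzero in *; lra.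
  - assert (Hdot : 2 * dot (vsub x y) x = sqnorm (vsub x y)).
    { rewrite sqnorm_sub, dot_sub_l, (dot_comm y x); fold (sqnorm x); lra. }
    rewrite Hdot; unfold vsub at 1, vscale; field_simplify; [unfold vsub; ring|exact E0].
Qed.

(** * Coordinates *)

Definition idx {d} (i : Fin.t d) : nat := proj1_sig (Fin.to_nat i).

Lemma idx_lt {d} (i : Fin.t d) : (idx i < d)%nat.
Proof. exact (proj2_sig (Fin.to_nat i)). Qed.

Lemma idx_FS {d} (i : Fin.t d) : idx (Fin.FS i) = S (idx i).
Proof. unfold idx; simpl; destruct (Fin.to_nat i); reflexivity. Qed.

Lemma fsum_telescope d (f : nat -> R) : fsum d (fun i => f (idx i) - f (S (idx i))) = f 0%nat - f d.
Proof.
  revert f; induction d as [|d IH]; intros f; cbn [fsum]; [ring|].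
  rewrite (fsum_ext _ _ (fun i => f (S (idx i)) - f (S (S (idx i)))))
    by (intros i; rewrite idx_FS; reflexivity).
  rewrite (IH (fun j => f (S j))); unfold idx; simpl; ring.
Qed.

Lemma fsum_idx_indicator d k c :
  (k < d)%nat -> fsum d (fun i => if Nat.eqb (idx i) k then c else 0) = c.
Proof.
  intros Hk; set (f := fun j => if Nat.leb j k then c else 0).
  rewrite (fsum_ext _ _ (fun i => f (idx i) - f (S (idx i)))).
  - rewrite fsum_telescope; unfold f; rewrite (proj2 (Nat.leb_gt d k)) by exact Hk; simpl; ring.
  - intros i; unfold f.
    destruct (Nat.eqb_spec (idx i) k), (Nat.leb_spec (idx i) k), (Nat.leb_spec (S (idx i)) k);
      lia || ring.
Qed.

Definition supp {d} (k : nat) (y : Vec d) : Prop := forall i, (k < idx i)%nat -> y i = 0.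

Lemma supp_subspace d k : subspace (@supp d k).
Proof.
  repeat split.
  - intros x y Hx Hy i Hi; unfold vadd; rewrite (Hx i Hi), (Hy i Hi); ring.
  - intros a x Hx i Hi; unfold vscale; rewrite (Hx i Hi); ring.
Qed.

Lemma supp_mono d k k' (y : Vec d) : (k <= k')%nat -> supp k y -> supp k' y.
Proof. intros Hk Hy i Hi; apply Hy; lia. Qed.

(** * Smoothness, strong convexity and proximal points *)

Lemma has_gradient_of_quadratic_remainder d (g : Vec d -> R) x v K :
  0 < K ->
  (forall y, Rabs (g y - g x - dot v (vsub y x)) <= K * sqnorm (vsub y x)) ->
  has_gradient g x v.
Proof.
  intros HK Hg e He; exists (e / K); split; [apply Rdiv_lt_0_compat; assumption|].
  intros y Hy; eapply Rle_trans; [apply Hg|].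
  rewrite <- norm_sqr, <- Rmult_assoc; apply Rmult_le_compat_r; [apply norm_ge0|].
  apply (Rmult_lt_compat_l K) in Hy; [|exact HK].
  replace (K * (e / K)) with e in Hy by (field; lra); lra.
Qed.

Lemma is_prox_of_stationary d mu (g : Vec d -> R) gg gamma x u :
  0 <= mu -> 0 < gamma -> strongly_convex mu g gg ->
  (forall i, gg u i = / gamma * (x i - u i)) -> is_prox g gamma x u.
Proof.
  intros Hmu Hgamma Hg Hu v; specialize (Hg u v).
  assert (Hdot : dot (gg u) (vsub v u) = / gamma * dot (vsub x u) (vsub v u)).
  { rewrite <- dot_scale_l; apply fsum_ext; intros i; rewrite Hu; reflexivity. }
  assert (Hxv : sqnorm (vsub x v)
                = sqnorm (vsub x u) - 2 * dot (vsub x u) (vsub v u) + sqnorm (vsub v u)).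
  { rewrite <- sqnorm_sub; apply fsum_ext; intros i; unfold vsub; ring. }
  rewrite Hxv, Rinv_mult; rewrite Hdot in Hg.
  pose proof (sqnorm_ge0 (vsub v u)); pose proof (Rinv_0_lt_compat _ Hgamma); nra.
Qed.

Lemma favg_growth n d mu (fs : Fin.t n -> Vec d -> R) gfs xstar :
  (1 <= n)%nat -> (forall j, strongly_convex mu (fs j) (gfs j)) ->
  (forall h, fsum n (fun j => dot (gfs j xstar) h) = 0) ->
  forall x, favg fs xstar + mu / 2 * sqnorm (vsub x xstar) <= favg fs x.
Proof.
  intros Hn Hsc Hstat x; unfold favg; set (D := mu / 2 * sqnorm (vsub x xstar)).
  assert (HN : 0 < INR n) by (apply lt_0_INR; lia).
  replace (_ + D) with (/ INR n * (fsum n (fun j => fs j xstar) + INR n * D)) by (field; lra).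
  apply Rmult_le_compat_l; [left; apply Rinv_0_lt_compat, HN|].
  rewrite <- (fsum_const n D), <- (Rplus_0_r (fsum n (fun j => fs j xstar))).
  rewrite <- (Hstat (vsub x xstar)), <- !fsum_plus; apply fsum_le; intros j.
  apply Rge_le, Hsc.
Qed.

Section ComposeReflection.

Context {d : nat} {H : Vec d -> Vec d} {g : Vec d -> R} {gg : Vec d -> Vec d}.
Hypothesis Hrefl : reflection H.

Lemma reflection_sub x y : H (vsub x y) = vsub (H x) (H y).
Proof. apply symmetric_sub, Hrefl. Qed.

Lemma is_gradient_comp_reflection :
  is_gradient g gg -> is_gradient (fun x => g (H x)) (fun x => H (gg (H x))).
Proof.
  intros Hg x e He; destruct (Hg (H x) e He) as (delta & Hdelta & Hy).
  exists delta; split; [exact Hdelta|]; intros y Hyx.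
  rewrite (proj1 Hrefl), reflection_sub.
  rewrite <- (reflection_norm H) in * by exact Hrefl; rewrite reflection_sub in *.
  apply Hy, Hyx.
Qed.

Lemma L_smooth_comp_reflection L : L_smooth L gg -> L_smooth L (fun x => H (gg (H x))).
Proof.
  intros Hg x y; rewrite <- reflection_sub, reflection_norm by exact Hrefl.
  rewrite <- (reflection_norm H (vsub x y)), reflection_sub by exact Hrefl; apply Hg.
Qed.

Lemma strongly_convex_comp_reflection mu :
  strongly_convex mu g gg -> strongly_convex mu (fun x => g (H x)) (fun x => H (gg (H x))).
Proof.
  intros Hg x y; rewrite (proj1 Hrefl), <- (reflection_sqnorm H (vsub y x)) by exact Hrefl.
  rewrite reflection_sub; apply Hg.
Qed.

Lemma is_prox_comp_reflection gamma x u :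
  is_prox g gamma (H x) u -> is_prox (fun x => g (H x)) gamma x (H u).
Proof.
  intros Hu v; rewrite <- !(reflection_sqnorm H (vsub _ _)), !reflection_sub by exact Hrefl.
  rewrite (proj2 Hrefl); apply Hu.
Qed.

End ComposeReflection.

Definition quad {d} (M : Vec d -> Vec d) (b x : Vec d) : R := / 2 * dot x (M x) - dot b x.

Definition quad_grad {d} (M : Vec d -> Vec d) (b x : Vec d) : Vec d := vsub (M x) b.

Section Quadratic.

Context {d : nat} {M : Vec d -> Vec d} (b : Vec d).
Hypothesis Msym : symmetric M.

Lemma quad_taylor x y :
  quad M b y = quad M b x + dot (quad_grad M b x) (vsub y x) + / 2 * dot (vsub y x) (M (vsub y x)).
Proof.
  unfold quad, quad_grad.
  rewrite (symmetric_sub Msym), !dot_sub_l, !dot_sub_r, (Msym x y), (Msym x x).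
  rewrite (dot_comm y (M x)), (Msym x y); lra.
Qed.

Lemma quad_trapezoid x y :
  quad M b y - quad M b x
  = / 2 * (dot (quad_grad M b x) (vsub y x) + dot (quad_grad M b y) (vsub y x)).
Proof.
  rewrite (quad_taylor x y), (symmetric_sub Msym), (dot_comm _ (vsub (M y) (M x))).
  unfold quad_grad; rewrite !(dot_sub_l (vsub y x)); lra.
Qed.

Lemma quad_is_gradient L :
  0 < L -> (forall h, 0 <= dot h (M h) <= L * sqnorm h) -> is_gradient (quad M b) (quad_grad M b).
Proof.
  intros HL HM x; apply has_gradient_of_quadratic_remainder with L; [exact HL|].
  intros y; rewrite (quad_taylor x y); specialize (HM (vsub y x)).
  pose proof (sqnorm_ge0 (vsub y x)).
  replace (_ - _ - _) with (/ 2 * dot (vsub y x) (M (vsub y x))) by ring.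
  rewrite Rabs_pos_eq; nra.
Qed.

Lemma quad_L_smooth L :
  0 <= L -> (forall h, sqnorm (M h) <= L * L * sqnorm h) -> L_smooth L (quad_grad M b).
Proof.
  intros HL HM x y; apply norm_le_of_sqnorm_le; [exact HL|].
  replace (vsub (quad_grad M b x) (quad_grad M b y)) with (M (vsub x y)); [apply HM|].
  rewrite (symmetric_sub Msym); apply functional_extensionality; intros i.
  unfold quad_grad, vsub; ring.
Qed.

Lemma quad_strongly_convex mu :
  (forall h, mu * sqnorm h <= dot h (M h)) -> strongly_convex mu (quad M b) (quad_grad M b).
Proof. intros HM x y; rewrite (quad_taylor x y); specialize (HM (vsub y x)); lra. Qed.

End Quadratic.

(** * Contractions and weighted involutions *)

Section SymmetricContraction.

Context {d : nat} (mu w : R) (T : Vec d -> Vec d).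
Hypothesis Tsym : symmetric T.
Hypothesis Tcontr : forall h, sqnorm (T h) <= sqnorm h.
Hypotheses (Hmu : 0 <= mu) (Hw : 0 <= w).

Definition damped_laplacian (y : Vec d) : Vec d := vadd (vscale mu y) (vscale w (vsub y (T y))).

Lemma damped_laplacian_symmetric : symmetric damped_laplacian.
Proof.
  intros x y; unfold damped_laplacian.
  rewrite dot_add_l, dot_add_r, !dot_scale_l, !dot_scale_r, dot_sub_l, dot_sub_r, Tsym; reflexivity.
Qed.

Lemma contraction_dot_bounds h : - sqnorm h <= dot h (T h) <= sqnorm h.
Proof.
  specialize (Tcontr h).
  pose proof (sqnorm_ge0 (vadd h (T h))) as Hadd; rewrite sqnorm_add in Hadd.
  pose proof (sqnorm_ge0 (vsub h (T h))) as Hsub; rewrite sqnorm_sub in Hsub; lra.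
Qed.

Lemma damped_laplacian_form_bounds h :
  mu * sqnorm h <= dot h (damped_laplacian h) <= (mu + 2 * w) * sqnorm h.
Proof.
  unfold damped_laplacian; rewrite dot_add_r, !dot_scale_r, dot_sub_r; fold (sqnorm h).
  pose proof (contraction_dot_bounds h); nra.
Qed.

Lemma damped_laplacian_sqnorm_le h :
  sqnorm (damped_laplacian h) <= (mu + 2 * w) * (mu + 2 * w) * sqnorm h.
Proof.
  replace (damped_laplacian h) with (vsub (vscale (mu + w) h) (vscale w (T h)))
    by (apply functional_extensionality; intros i;
        unfold damped_laplacian, vadd, vsub, vscale; ring).
  rewrite sqnorm_sub, !sqnorm_scale, dot_scale_l, dot_scale_r.
  assert (Hcross : w * (mu + w) * - dot h (T h) <= w * (mu + w) * sqnorm h)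
    by (apply Rmult_le_compat_l; [nra|pose proof (contraction_dot_bounds h); lra]).
  assert (Hsquare : w * w * sqnorm (T h) <= w * w * sqnorm h)
    by (apply Rmult_le_compat_l; [nra|apply Tcontr]).
  lra.
Qed.

End SymmetricContraction.

Section WeightedInvolution.

Context {d : nat} (sg : Fin.t d -> R) (pi : Fin.t d -> Fin.t d).
Hypothesis pi_inv : forall i, pi (pi i) = i.
Hypothesis sg_pi : forall i, sg (pi i) = sg i.
Hypothesis sg_bound : forall i, -1 <= sg i <= 1.

Definition wswap (y : Vec d) : Vec d := fun i => sg i * y (pi i).

Lemma wswap_symmetric : symmetric wswap.
Proof.
  intros x y; unfold dot, wswap.
  rewrite <- (fsum_involution d pi (fun i => x i * _) pi_inv).
  apply fsum_ext; intros i; rewrite sg_pi, pi_inv; ring.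
Qed.

Lemma wswap_contraction h : sqnorm (wswap h) <= sqnorm h.
Proof.
  unfold sqnorm, dot, wswap; rewrite <- (fsum_involution d pi (fun i => h i * h i) pi_inv).
  apply fsum_le; intros i; specialize (sg_bound i).
  assert (sg i * sg i <= 1) by nra; pose proof (Rle_0_sqr (h (pi i))); unfold Rsqr in *; nra.
Qed.

(* The square of [T := wswap] is the diagonal [sg^2], so [c - w T] is inverted by
   [(c + w T) / (c^2 - w^2 sg^2)]. *)
Definition wswap_resolvent (c w : R) (q : Vec d) : Vec d :=
  fun i => (c * q i + w * wswap q i) / (c * c - w * sg i * (w * sg i)).

Lemma wswap_resolvent_spec c w q i :
  0 <= w < c -> c * wswap_resolvent c w q i - w * wswap (wswap_resolvent c w q) i = q i.
Proof.
  intros Hcw; specialize (sg_bound i).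
  assert (Hdet : 0 < c * c - w * sg i * (w * sg i)).
  { assert (- w <= w * sg i <= w) by nra; nra. }
  unfold wswap_resolvent, wswap; rewrite sg_pi, pi_inv; field; lra.
Qed.

End WeightedInvolution.

(** * Expected progress of a run *)

Section Run.

Context {n d : nat} (A : PIFO n) (fs : Fin.t n -> Vec d -> R) (gfs : Fin.t n -> Vec d -> Vec d).
Variables (prx : Fin.t n -> R -> Vec d -> Vec d) (W : nat -> Vec d -> Prop) (key : nat -> Fin.t n).
Hypothesis HA : is_PIFO A.

Definition advance (k : nat) (j : Fin.t n) : nat := if Fin.eq_dec j (key k) then S k else k.

Hypothesis W_subspace : forall k, subspace (W k).
Hypothesis W_succ : forall k x, W k x -> W (S k) x.
Hypothesis W_grad : forall k j x, W k x -> W (advance k j) (gfs j x).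
Hypothesis W_prox : forall k j gamma x, 0 < gamma -> W k x -> W (advance k j) (prx j gamma x).

Lemma cur_iterate_in_flag h k :
  Forall (W k) (hist_vectors (pifo_x0 A d) h) -> W k (cur_iterate A h).
Proof.
  destruct HA as (_ & _ & _ & Hspan); intros Hh.
  destruct h as [|o h]; [exact (Forall_inv Hh)|].
  eapply in_span_subspace; [apply W_subspace|exact Hh|apply Hspan; discriminate].
Qed.

Lemma hist_in_flag_step h k j (v : R)
    (gamma := pifo_gamma A (S (length h))) (x := cur_iterate A h) :
  Forall (W k) (hist_vectors (pifo_x0 A d) h) ->
  Forall (W (advance k j))
    (hist_vectors (pifo_x0 A d) (h ++ [Obs x j v (gfs j x) (prx j gamma x)])).
Proof.
  intros Hh; pose proof (cur_iterate_in_flag h k Hh) as Hx.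
  assert (Hup : forall y, W k y -> W (advance k j) y)
    by (intros y Hy; unfold advance; destruct (Fin.eq_dec j (key k)); [apply W_succ|]; exact Hy).
  destruct HA as (_ & _ & Hgamma & _).
  unfold hist_vectors; rewrite flat_map_app, app_comm_cons; apply Forall_app; split.
  - eapply Forall_impl; [exact Hup|exact Hh].
  - simpl; repeat constructor; [apply Hup, Hx|apply W_grad, Hx|apply W_prox, Hx].
    apply Hgamma; lia.
Qed.

Variables (q rho : R).
Hypothesis key_unlikely : forall k, pifo_p A (key k) <= q.
Hypotheses (Hq : 0 <= q <= 1) (Hrho : 0 <= rho <= 1).

Lemma mean_pow_advance_ge k :
  rho ^ k * (1 - q * (1 - rho)) <= fsum n (fun j => pifo_p A j * rho ^ advance k j).
Proof.
  destruct HA as (_ & Hsum & _).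
  rewrite (fsum_ext _ _ (fun j => rho ^ k * pifo_p A j
    - (if Fin.eq_dec j (key k) then rho ^ k * (1 - rho) * pifo_p A (key k) else 0))).
  - rewrite fsum_minus, fsum_scal, fsum_indicator, Hsum.
    assert (rho ^ k * (1 - rho) * pifo_p A (key k) <= rho ^ k * (1 - rho) * q); [|lra].
    apply Rmult_le_compat_l; [|apply key_unlikely].
    apply Rmult_le_pos; [apply pow_le|]; lra.
  - intros j; unfold advance; destruct (Fin.eq_dec j (key k)) as [->|_]; simpl; ring.
Qed.

Lemma expect_run_ge (Phi : Vec d -> R) (K T : R) :
  0 <= K -> (forall k x, W k x -> K * rho ^ k + T <= Phi x) ->
  forall t h k, Forall (W k) (hist_vectors (pifo_x0 A d) h) ->
  K * ((1 - q * (1 - rho)) ^ t * rho ^ k) + T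
  <= expect (pifo_p A) t (fun s => Phi (cur_iterate A (run A fs gfs prx h s))).
Proof.
  intros HK HPhi; set (th := 1 - q * (1 - rho)).
  assert (Hth : 0 <= th) by (unfold th; nra).
  induction t as [|t IH]; intros h k Hh.
  - simpl; rewrite Rmult_1_l; apply HPhi, cur_iterate_in_flag, Hh.
  - apply Rle_trans with
      (fsum n (fun j => pifo_p A j * (K * (th ^ t * rho ^ advance k j) + T))).
    + rewrite (fsum_ext _ _ (fun j => K * th ^ t * (pifo_p A j * rho ^ advance k j)
        + T * pifo_p A j)) by (intros j; ring).
      rewrite fsum_plus, !fsum_scal, (proj1 (proj2 HA)).
      assert (K * th ^ t * (rho ^ k * th)
              <= K * th ^ t * fsum n (fun j => pifo_p A j * rho ^ advance k j)).
      { apply Rmult_le_compat_l; [|apply mean_pow_advance_ge].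
        apply Rmult_le_pos; [exact HK|apply pow_le, Hth]. }
      simpl; lra.
    + apply fsum_le; intros j; apply Rmult_le_compat_l; [apply (proj1 HA)|].
      apply IH, hist_in_flag_step, Hh.
Qed.

End Run.

(** * The chain *)

(* [Linking e] holds the links [j -- j+1] with [Nat.even j = e]. *)
Inductive component : Type := Linking (e : bool) | Linkless.

Definition link (e : bool) (j : nat) : nat := if Bool.eqb (Nat.even j) e then S j else pred j.

Definition linked (m : nat) (e : bool) (j : nat) : bool :=
  Nat.leb 1 (Nat.min j (link e j)) && Nat.leb (Nat.max j (link e j)) m.

Definition partner_index (m : nat) (c : component) (j : nat) : nat :=
  match c with
  | Linking e => if linked m e j then link e j else j
  | Linkless => j
  end.

(* Weighting the self-loop of node [m] by [r] makes the geometric sequence an exact solution: the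
   value missing at node [m + 1] is replaced by [r * y_m]. *)
Definition weight (m : nat) (r : R) (c : component) (j : nat) : R :=
  match c with
  | Linking e => if Nat.eqb (link e j) (S m) then r else 1
  | Linkless => 1
  end.

Definition progress (k : nat) (c : component) : nat :=
  match c with
  | Linking e => if Bool.eqb (Nat.even k) e then S k else k
  | Linkless => k
  end.

Lemma eqb_even_S j e : Bool.eqb (Nat.even (S j)) e = negb (Bool.eqb (Nat.even j) e).
Proof. rewrite Nat.even_succ, <- Nat.negb_even; destruct (Nat.even j), e; reflexivity. Qed.

Lemma link_bounds e j : (pred j <= link e j <= S j)%nat.
Proof. unfold link; destruct (Bool.eqb _ _); lia. Qed.

Lemma link_involutive e j : link e (link e j) = j.
Proof.
  unfold link at 2; destruct (Bool.eqb (Nat.even j) e) eqn:E.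
  - unfold link; rewrite eqb_even_S, E; reflexivity.
  - destruct j as [|j]; [simpl; unfold link; rewrite E; reflexivity|].
    rewrite eqb_even_S in E; apply Bool.negb_false_iff in E.
    unfold link; simpl pred; rewrite E; reflexivity.
Qed.

Lemma link_true_false (f : nat -> R) j : f (link true j) + f (link false j) = f (S j) + f (pred j).
Proof. unfold link; destruct (Nat.even j); simpl; ring. Qed.

Lemma linked_link m e j : linked m e (link e j) = linked m e j.
Proof. unfold linked; rewrite link_involutive, Nat.min_comm, Nat.max_comm; reflexivity. Qed.

Lemma linked_iff m e j : linked m e j = true <-> (1 <= j <= m /\ 1 <= link e j <= m)%nat.
Proof. unfold linked; rewrite Bool.andb_true_iff, !Nat.leb_le; lia. Qed.

Lemma partner_index_involutive m c j : partner_index m c (partner_index m c j) = j.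
Proof.
  destruct c as [e|]; [unfold partner_index|reflexivity].
  destruct (linked m e j) eqn:E; rewrite ?linked_link, E, ?link_involutive; reflexivity.
Qed.

Lemma partner_index_lt m c j : (j < S m)%nat -> (partner_index m c j < S m)%nat.
Proof.
  intros Hj; destruct c as [e|]; [unfold partner_index|exact Hj].
  destruct (linked m e j) eqn:E; [apply linked_iff in E|]; lia.
Qed.

Lemma weight_partner_index m r c j : weight m r c (partner_index m c j) = weight m r c j.
Proof.
  destruct c as [e|]; [unfold weight, partner_index|reflexivity].
  destruct (linked m e j) eqn:E; [apply linked_iff in E|reflexivity].
  rewrite link_involutive.
  destruct (Nat.eqb_spec j (S m)), (Nat.eqb_spec (link e j) (S m)); lia || reflexivity.
Qed.

Lemma weight_0 m r c : (1 <= m)%nat -> weight m r c 0 = 1.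
Proof.
  intros Hm; destruct c as [e|]; [unfold weight|reflexivity].
  destruct (Nat.eqb_spec (link e 0) (S m)); [pose proof (link_bounds e 0); lia|reflexivity].
Qed.

Lemma weight_bounds m r c j : -1 <= r <= 1 -> -1 <= weight m r c j <= 1.
Proof. intros Hr; destruct c as [e|]; simpl; [destruct (Nat.eqb _ _)|]; lra. Qed.

Lemma progress_ge k c : (k <= progress k c)%nat.
Proof. destruct c as [e|]; simpl; [destruct (Bool.eqb _ _)|]; lia. Qed.

Lemma lt_partner_index m c k j : (progress k c < j)%nat -> (k < partner_index m c j)%nat.
Proof.
  destruct c as [e|]; [unfold progress, partner_index|simpl; lia].
  pose proof (link_bounds e j); intros Hj.
  assert (Hlink : (k < link e j)%nat); [|destruct (linked m e j), (Bool.eqb _ _); lia].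
  destruct (Bool.eqb (Nat.even k) e) eqn:E; [lia|].
  destruct (Nat.eq_dec j (S k)) as [->|Hne]; [|lia].
  unfold link; rewrite eqb_even_S, E; simpl; lia.
Qed.

Definition geom_seq (r z a : R) (j : nat) : R := match j with O => z | _ => a * r ^ j end.

Lemma weighted_difference_geom_seq m r z a e j : (1 <= j <= m)%nat ->
  geom_seq r z a j - weight m r (Linking e) j * geom_seq r z a (partner_index m (Linking e) j)
  = if Nat.eqb (link e j) 0 then 0 else a * r ^ j - a * r ^ link e j.
Proof.
  intros Hj; unfold weight, partner_index; pose proof (link_bounds e j).
  assert (Egeom : forall l, (1 <= l)%nat -> geom_seq r z a l = a * r ^ l)
    by (intros [|l]; [lia|reflexivity]).
  destruct (linked m e j) eqn:E.
  - apply linked_iff in E; destruct (Nat.eqb_spec (link e j) (S m)); [lia|].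
    destruct (Nat.eqb_spec (link e j) 0); [lia|].
    rewrite !Egeom by lia; ring.
  - assert (Hout : link e j = 0%nat \/ link e j = S m /\ j = m).
    { apply Bool.not_true_iff_false in E; rewrite linked_iff in E; lia. }
    rewrite Egeom by lia; destruct Hout as [->|[-> ->]]; simpl; [ring|].
    rewrite Nat.eqb_refl; ring.
Qed.

(** * The hard instance *)

Section HardInstance.

Variables (m : nat) (mu w r B z : R).

Definition source (c : component) (j : nat) : R :=
  match j with
  | O => mu * z
  | 1%nat => match c with Linking true => w * (1 - r) * B | _ => 0 end
  | _ => 0
  end.

Definition partner (c : component) (i : Fin.t (S m)) : Fin.t (S m) :=
  Fin.of_nat_lt (partner_index_lt m c (idx i) (idx_lt i)).

Definition chain_swap (c : component) : Vec (S m) -> Vec (S m) :=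
  wswap (fun i => weight m r c (idx i)) (partner c).

Definition chain_op (c : component) : Vec (S m) -> Vec (S m) :=
  damped_laplacian mu w (chain_swap c).

Definition chain_source (c : component) : Vec (S m) := fun i => source c (idx i).

Definition chain_fun (c : component) : Vec (S m) -> R := quad (chain_op c) (chain_source c).

Definition chain_grad (c : component) : Vec (S m) -> Vec (S m) :=
  quad_grad (chain_op c) (chain_source c).

Definition chain_prox (c : component) (gamma : R) (x : Vec (S m)) : Vec (S m) :=
  wswap_resolvent (fun i => weight m r c (idx i)) (partner c) (mu + w + / gamma) w
    (vadd (chain_source c) (vscale (/ gamma) x)).

Definition chain_vec (a : R) : Vec (S m) := fun i => geom_seq r z a (idx i).

Lemma idx_partner c i : idx (partner c i) = partner_index m c (idx i).
Proof. unfold idx at 1, partner; rewrite Fin.to_nat_of_nat; reflexivity. Qed.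

Lemma partner_involutive c i : partner c (partner c i) = i.
Proof.
  apply Fin.to_nat_inj; change (idx (partner c (partner c i)) = idx i).
  rewrite !idx_partner; apply partner_index_involutive.
Qed.

Lemma weight_partner c i : weight m r c (idx (partner c i)) = weight m r c (idx i).
Proof. rewrite idx_partner; apply weight_partner_index. Qed.

Lemma chain_swap_symmetric c : symmetric (chain_swap c).
Proof. apply wswap_symmetric; [apply partner_involutive|apply weight_partner]. Qed.

Lemma chain_op_symmetric c : symmetric (chain_op c).
Proof. apply damped_laplacian_symmetric, chain_swap_symmetric. Qed.

Lemma source_linked e j : linked m e j = true -> source (Linking e) j = 0.
Proof.
  intros E; apply linked_iff in E; destruct j as [|[|j]]; [lia| |reflexivity].
  destruct e; [unfold link in E; simpl in E; lia|reflexivity].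
Qed.

Lemma source_partner_index c j : source c (partner_index m c j) = source c j.
Proof.
  destruct c as [e|]; [unfold partner_index|reflexivity].
  destruct (linked m e j) eqn:E; [|reflexivity].
  rewrite !source_linked by (rewrite ?linked_link; exact E); reflexivity.
Qed.

Lemma source_eq0 c k j : (progress k c < j)%nat -> source c j = 0.
Proof.
  intros Hj; pose proof (progress_ge k c); destruct j as [|[|j]]; [lia| |reflexivity].
  destruct c as [[|]|]; [|reflexivity..].
  assert (k = 0%nat) as -> by lia; simpl in Hj; lia.
Qed.

Lemma chain_grad_supp c k y : supp k y -> supp (progress k c) (chain_grad c y).
Proof.
  intros Hy i Hi; pose proof (progress_ge k c).
  unfold chain_grad, quad_grad, chain_op, damped_laplacian, chain_swap, wswap, chain_source,
    vadd, vsub, vscale.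
  rewrite (source_eq0 _ k) by exact Hi.
  rewrite (Hy i) by lia; rewrite (Hy (partner c i)); [ring|].
  rewrite idx_partner; apply lt_partner_index, Hi.
Qed.

Lemma chain_prox_supp c gamma k x : supp k x -> supp (progress k c) (chain_prox c gamma x).
Proof.
  intros Hx i Hi; pose proof (progress_ge k c).
  unfold chain_prox, wswap_resolvent, wswap, chain_source, vadd, vscale.
  rewrite idx_partner, source_partner_index, (source_eq0 _ k) by exact Hi.
  rewrite (Hx i) by lia; rewrite (Hx (partner c i)); [unfold Rdiv; ring|].
  rewrite idx_partner; apply lt_partner_index, Hi.
Qed.

Lemma chain_vec_0_supp : supp 0 (chain_vec 0).
Proof. intros i Hi; unfold chain_vec; destruct (idx i); [lia|]; simpl; ring. Qed.

Lemma chain_grad_chain_vec c a i :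
  chain_grad c (chain_vec a) i
  = mu * geom_seq r z a (idx i)
    + w * (geom_seq r z a (idx i)
           - weight m r c (idx i) * geom_seq r z a (partner_index m c (idx i)))
    - source c (idx i).
Proof.
  unfold chain_grad, quad_grad, chain_op, damped_laplacian, chain_swap, wswap, chain_source,
    chain_vec, vadd, vsub, vscale.
  rewrite idx_partner; reflexivity.
Qed.

Hypothesis Hr : 0 <= r < 1.

(* The left-hand side telescopes over the coordinates after [k]. *)
Lemma sqnorm_sub_chain_vec_ge k y : supp k y -> (k <= m)%nat ->
  B * B * ((r * r) ^ S k - (r * r) ^ S m) <= (1 - r * r) * sqnorm (vsub y (chain_vec B)).
Proof.
  intros Hy Hk; set (f := fun j => B * B * (r * r) ^ Nat.max (S k) j).
  assert (Ef : B * B * ((r * r) ^ S k - (r * r) ^ S m) = f 0%nat - f (S m))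
    by (unfold f; rewrite Nat.max_0_r, (Nat.max_r _ (S m)) by lia; ring).
  rewrite Ef, <- fsum_telescope; unfold sqnorm, dot; rewrite <- fsum_scal.
  apply fsum_le; intros i; unfold f; destruct (Nat.leb_spec (idx i) k) as [Hi|Hi].
  - rewrite !Nat.max_l by lia; rewrite Rminus_diag; apply Rmult_le_pos; nra.
  - rewrite !Nat.max_r by lia; unfold vsub, chain_vec; rewrite (Hy i Hi).
    destruct (idx i) as [|j]; [lia|].
    apply Req_le; unfold geom_seq; rewrite !Rpow_mult_distr; simpl; ring.
Qed.

Lemma chain_swap_contraction c h : sqnorm (chain_swap c h) <= sqnorm h.
Proof.
  apply wswap_contraction; [apply partner_involutive|].
  intros i; apply weight_bounds; lra.
Qed.

Hypotheses (Hmu : 0 < mu) (Hw : 0 <= w).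

Lemma chain_op_form_bounds c h :
  mu * sqnorm h <= dot h (chain_op c h) <= (mu + 2 * w) * sqnorm h.
Proof. apply damped_laplacian_form_bounds; auto using chain_swap_contraction. Qed.

Lemma chain_is_gradient c : is_gradient (chain_fun c) (chain_grad c).
Proof.
  apply quad_is_gradient with (mu + 2 * w); [apply chain_op_symmetric|lra|].
  intros h; pose proof (chain_op_form_bounds c h); pose proof (sqnorm_ge0 h); nra.
Qed.

Lemma chain_L_smooth c : L_smooth (mu + 2 * w) (chain_grad c).
Proof.
  apply quad_L_smooth; [apply chain_op_symmetric|lra|]; intros h.
  apply damped_laplacian_sqnorm_le; auto using chain_swap_contraction; lra.
Qed.

Lemma chain_strongly_convex c : strongly_convex mu (chain_fun c) (chain_grad c).
Proof.
  apply quad_strongly_convex; [apply chain_op_symmetric|].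
  intros h; apply chain_op_form_bounds.
Qed.

Lemma chain_is_prox c gamma x : 0 < gamma -> is_prox (chain_fun c) gamma x (chain_prox c gamma x).
Proof.
  intros Hgamma; apply is_prox_of_stationary with mu (chain_grad c);
    [lra|exact Hgamma|apply chain_strongly_convex|intros i].
  assert (Hres : (mu + w + / gamma) * chain_prox c gamma x i
                 - w * chain_swap c (chain_prox c gamma x) i
                 = vadd (chain_source c) (vscale (/ gamma) x) i).
  { apply wswap_resolvent_spec; [apply partner_involutive|apply weight_partner| |].
    - intros j; apply weight_bounds; lra.
    - pose proof (Rinv_0_lt_compat _ Hgamma); lra. }
  unfold chain_grad, quad_grad, chain_op, damped_laplacian, vadd, vsub, vscale in *; lra.
Qed.

Hypothesis Hm : (1 <= m)%nat.

Lemma dot_chain_grad_start c :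
  dot (chain_grad c (chain_vec 0)) (vsub (chain_vec 0) (chain_vec B)) = source c 1 * (B * r).
Proof.
  rewrite <- (fsum_idx_indicator (S m) 1) by lia; apply fsum_ext; intros i.
  rewrite chain_grad_chain_vec; unfold vsub, chain_vec; pose proof (idx_lt i).
  destruct (idx i) as [|j]; [simpl; ring|].
  assert (Hdiff : geom_seq r z 0 (S j)
                  - weight m r c (S j) * geom_seq r z 0 (partner_index m c (S j)) = 0).
  { destruct c as [e|]; [|simpl; ring].
    rewrite weighted_difference_geom_seq by lia; destruct (Nat.eqb _ _); ring. }
  rewrite Hdiff; destruct j as [|j]; simpl; ring.
Qed.

(* At [y_1 = B * r] the driving term [w * (1 - r) * B] acts as a link to a node of value [B]. *)
Lemma chain_grad_balance N i : w * ((1 - r) * (1 - r)) = N * mu * r ->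
  (N - 2) * chain_grad Linkless (chain_vec B) i
  + chain_grad (Linking true) (chain_vec B) i + chain_grad (Linking false) (chain_vec B) i = 0.
Proof.
  intros Hratio; rewrite !chain_grad_chain_vec; pose proof (idx_lt i).
  destruct (idx i) as [|[|j]].
  - rewrite !weight_0 by exact Hm; simpl; ring.
  - rewrite !weighted_difference_geom_seq by lia; simpl.
    transitivity (B * (N * mu * r - w * ((1 - r) * (1 - r)))); [ring|rewrite Hratio; ring].
  - rewrite !weighted_difference_geom_seq by lia; set (l := S (S j)).
    assert (Hne : forall e, Nat.eqb (link e l) 0 = false)
      by (intros e; apply Nat.eqb_neq; pose proof (link_bounds e l); lia).
    rewrite !Hne.
    transitivity (N * mu * r * (B * r ^ S j)
      + w * (2 * (B * r ^ l) - B * (r ^ link true l + r ^ link false l)));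
      [unfold l; simpl; ring|].
    rewrite (link_true_false (pow r)), <- Hratio; unfold l; simpl; ring.
Qed.

Variables (n : nat) (Delta : R) (a b : Fin.t n).
Hypothesis Hn : (2 <= n)%nat.
Hypothesis Hab : a <> b.
Hypothesis Hratio : w * ((1 - r) * (1 - r)) = INR n * mu * r.
Hypothesis Hamplitude : mu * (r * r) * (B * B) = 2 * (1 - r) * Delta.

Definition assign (j : Fin.t n) : component :=
  if Fin.eq_dec j a then Linking true else if Fin.eq_dec j b then Linking false else Linkless.

Lemma fsum_assign (g : component -> R) :
  fsum n (fun j => g (assign j))
  = (INR n - 2) * g Linkless + g (Linking true) + g (Linking false).
Proof.
  rewrite (fsum_ext _ _ (fun j => g Linkless
    + (if Fin.eq_dec j a then g (Linking true) - g Linkless else 0)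
    + (if Fin.eq_dec j b then g (Linking false) - g Linkless else 0))).
  - rewrite !fsum_plus, fsum_const, !fsum_indicator; ring.
  - intros j; unfold assign.
    destruct (Fin.eq_dec j a), (Fin.eq_dec j b); [congruence|ring..].
Qed.

Definition chain_average : Vec (S m) -> R := favg (fun j => chain_fun (assign j)).

Lemma chain_average_stationary h :
  fsum n (fun j => dot (chain_grad (assign j) (chain_vec B)) h) = 0.
Proof.
  unfold dot; rewrite fsum_exchange, (fsum_ext _ _ (fun _ => 0)), fsum_0; [reflexivity|intros i].
  rewrite (fsum_assign (fun c => chain_grad c (chain_vec B) i * h i)).
  transitivity (h i * ((INR n - 2) * chain_grad Linkless (chain_vec B) i
    + chain_grad (Linking true) (chain_vec B) i
    + chain_grad (Linking false) (chain_vec B) i)); [ring|].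
  rewrite chain_grad_balance by assumption; ring.
Qed.

Lemma chain_average_growth y :
  chain_average (chain_vec B) + mu / 2 * sqnorm (vsub y (chain_vec B)) <= chain_average y.
Proof.
  apply favg_growth with (fun j => chain_grad (assign j)); [lia| |].
  - intros j; apply chain_strongly_convex; assumption.
  - exact chain_average_stationary.
Qed.

Lemma chain_average_min y : chain_average (chain_vec B) <= chain_average y.
Proof.
  pose proof (chain_average_growth y); pose proof (sqnorm_ge0 (vsub y (chain_vec B))); nra.
Qed.

Lemma chain_average_initial_gap : chain_average (chain_vec 0) - chain_average (chain_vec B) = Delta.
Proof.
  assert (HN : 0 < INR n) by (apply lt_0_INR; lia).
  unfold chain_average, favg; rewrite <- Rmult_minus_distr_l, <- fsum_minus.
  rewrite (fsum_ext _ _ (fun j => / 2 * (dot (chain_grad (assign j) (chain_vec B))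
      (vsub (chain_vec 0) (chain_vec B)) + source (assign j) 1 * (B * r)))).
  - rewrite fsum_scal, fsum_plus, chain_average_stationary.
    rewrite (fsum_assign (fun c => source c 1 * (B * r))); simpl.
    apply (Rmult_eq_reg_l (2 * (1 - r) * INR n)); [|nra].
    transitivity (w * ((1 - r) * (1 - r)) * r * (B * B)); [field; lra|].
    rewrite Hratio; transitivity (INR n * (mu * (r * r) * (B * B))); [ring|].
    rewrite Hamplitude; ring.
  - intros j; rewrite <- dot_chain_grad_start; apply quad_trapezoid, chain_op_symmetric.
Qed.

Lemma initial_gap_nonneg : 0 <= Delta.
Proof.
  apply (Rmult_le_reg_l (2 * (1 - r))); [lra|]; rewrite Rmult_0_r, <- Hamplitude.
  apply Rmult_le_pos; [apply Rmult_le_pos|]; nra.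
Qed.

Lemma chain_average_gap_ge k y : supp k y ->
  Delta / 2 * ((r * r) ^ k - (r * r) ^ m) <= chain_average y - chain_average (chain_vec B).
Proof.
  intros Hy; pose proof (chain_average_growth y) as Hgrowth.
  pose proof (sqnorm_ge0 (vsub y (chain_vec B))) as Hpos; pose proof initial_gap_nonneg as HDelta.
  apply Rle_trans with (mu / 2 * sqnorm (vsub y (chain_vec B))); [|lra].
  destruct (Nat.le_gt_cases k m) as [Hk|Hk].
  - assert (Htail : B * B * ((r * r) ^ S k - (r * r) ^ S m)
                    <= (1 - r * r) * sqnorm (vsub y (chain_vec B)))
      by (apply sqnorm_sub_chain_vec_ge; assumption).
    set (p := (r * r) ^ k - (r * r) ^ m); set (s := sqnorm (vsub y (chain_vec B))) in *.
    assert (Hscaled : (1 - r) * (2 * Delta * p) <= (1 - r) * ((1 + r) * (mu * s))).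
    { replace ((1 - r) * (2 * Delta * p)) with (mu * (r * r) * (B * B) * p)
        by (rewrite Hamplitude; ring).
      apply (Rmult_le_compat_l mu) in Htail; [|lra]; unfold p; simpl in Htail; lra. }
    apply Rmult_le_reg_l in Hscaled; [|lra].
    assert (0 <= mu * s) by (apply Rmult_le_pos; lra); nra.
  - assert ((r * r) ^ k <= (r * r) ^ m) by (apply pow_antitone; [nra|lia]); nra.
Qed.

Variables (A : PIFO n) (H : Vec (S m) -> Vec (S m)).
Hypotheses (HA : is_PIFO A) (Hrefl : reflection H).
Hypothesis Hstart : H (pifo_x0 A (S m)) = chain_vec 0.
Hypotheses (Ha : pifo_p A a <= 2 / INR n) (Hb : pifo_p A b <= 2 / INR n).

Definition hard_fun (j : Fin.t n) (x : Vec (S m)) : R := chain_fun (assign j) (H x).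

Definition hard_grad (j : Fin.t n) (x : Vec (S m)) : Vec (S m) :=
  H (chain_grad (assign j) (H x)).

Definition hard_prox (j : Fin.t n) (gamma : R) (x : Vec (S m)) : Vec (S m) :=
  H (chain_prox (assign j) gamma (H x)).

Lemma hard_is_gradient j : is_gradient (hard_fun j) (hard_grad j).
Proof. apply (is_gradient_comp_reflection Hrefl), chain_is_gradient. Qed.

Lemma hard_L_smooth j : L_smooth (mu + 2 * w) (hard_grad j).
Proof. apply (L_smooth_comp_reflection Hrefl), chain_L_smooth. Qed.

Lemma hard_strongly_convex j : strongly_convex mu (hard_fun j) (hard_grad j).
Proof. apply (strongly_convex_comp_reflection Hrefl), chain_strongly_convex. Qed.

Lemma hard_is_prox j gamma x :
  0 < gamma -> is_prox (hard_fun j) gamma x (hard_prox j gamma x).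
Proof. intros Hgamma; apply (is_prox_comp_reflection Hrefl), chain_is_prox, Hgamma. Qed.

Definition hard_min : Vec (S m) := H (chain_vec B).

Lemma favg_hard_min : favg hard_fun hard_min = chain_average (chain_vec B).
Proof.
  change (favg hard_fun hard_min) with (chain_average (H (H (chain_vec B)))).
  rewrite (proj2 Hrefl); reflexivity.
Qed.

Lemma hard_min_spec y : favg hard_fun hard_min <= favg hard_fun y.
Proof. rewrite favg_hard_min; exact (chain_average_min (H y)). Qed.

Lemma hard_initial_gap : favg hard_fun (pifo_x0 A (S m)) - favg hard_fun hard_min = Delta.
Proof.
  rewrite favg_hard_min.
  change (favg hard_fun (pifo_x0 A (S m))) with (chain_average (H (pifo_x0 A (S m)))).
  rewrite Hstart; apply chain_average_initial_gap.
Qed.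

Definition key (k : nat) : Fin.t n := if Nat.even k then a else b.

Lemma advance_key k j : advance key k j = progress k (assign j).
Proof.
  unfold advance, key, assign, progress.
  destruct (Nat.even k), (Fin.eq_dec j a), (Fin.eq_dec j b); simpl; congruence.
Qed.

Lemma hard_expected_gap_ge t :
  Delta / 2 * ((1 - 2 / INR n * (1 - r * r)) ^ t - (r * r) ^ m)
  <= expect (pifo_p A) t (fun s => favg hard_fun (iterate A hard_fun hard_grad hard_prox s))
     - favg hard_fun hard_min.
Proof.
  rewrite favg_hard_min.
  assert (HN : 2 <= INR n) by (apply (le_INR 2), Hn).
  pose proof (two_div_bounds (INR n) HN) as Hq.
  pose proof initial_gap_nonneg as HDelta.
  cut (Delta / 2 * ((1 - 2 / INR n * (1 - r * r)) ^ t * (r * r) ^ 0)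
       + (chain_average (chain_vec B) - Delta / 2 * (r * r) ^ m)
       <= expect (pifo_p A) t
            (fun s => favg hard_fun (iterate A hard_fun hard_grad hard_prox s))); [simpl; lra|].
  apply (expect_run_ge A hard_fun hard_grad hard_prox (fun k x => supp k (H x)) key HA);
    try nra.
  - intros k; apply subspace_preimage; [apply Hrefl|apply supp_subspace].
  - intros k x; apply supp_mono; lia.
  - intros k j x Hx; unfold hard_grad; rewrite (proj2 Hrefl), advance_key.
    apply chain_grad_supp, Hx.
  - intros k j gamma x _ Hx; unfold hard_prox; rewrite (proj2 Hrefl), advance_key.
    apply chain_prox_supp, Hx.
  - intros k; unfold key; destruct (Nat.even k); assumption.
  - intros k x Hx; pose proof (chain_average_gap_ge k (H x) Hx).
    change (favg hard_fun x) with (chain_average (H x)); lra.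
  - repeat constructor; rewrite Hstart; apply chain_vec_0_supp.
Qed.

End HardInstance.

Lemma exists_reflection_to_axis m r (x : Vec (S m)) :
  exists z H, reflection H /\ H x = chain_vec m r z 0.
Proof.
  exists (norm x), (householder (vsub x (chain_vec m r (norm x) 0))).
  split; [apply householder_reflection|apply householder_swap].
  rewrite <- (norm_sqr x), <- (fsum_idx_indicator (S m) 0 (norm x * norm x)) by lia.
  apply fsum_ext; intros i.
  unfold chain_vec; destruct (idx i); simpl; ring.
Qed.

Lemma exists_amplitude mu r Delta : 0 < mu -> 0 < r <= 1 -> 0 <= Delta ->
  exists B, mu * (r * r) * (B * B) = 2 * (1 - r) * Delta.
Proof.
  intros Hmu Hr HDelta; assert (Hden : 0 < mu * (r * r)) by (apply Rmult_lt_0_compat; nra).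
  exists (sqrt (2 * (1 - r) * Delta / (mu * (r * r)))); rewrite sqrt_sqrt; [field; nra|].
  apply Rmult_le_pos; [nra|left; apply Rinv_0_lt_compat, Hden].
Qed.

Lemma hard_instance n m (L mu r Delta : R) (A : PIFO n) :
  (2 <= n)%nat -> (1 <= m)%nat -> 0 < mu -> 0 < r < 1 -> 0 < Delta ->
  (L - mu) / 2 * ((1 - r) * (1 - r)) = INR n * mu * r -> is_PIFO A ->
  exists (fs : Fin.t n -> Vec (S m) -> R) (gfs : Fin.t n -> Vec (S m) -> Vec (S m))
         (prx : Fin.t n -> R -> Vec (S m) -> Vec (S m)) (xstar : Vec (S m)),
    (forall j, is_gradient (fs j) (gfs j)) /\
    (forall j, L_smooth L (gfs j)) /\
    (forall j, strongly_convex mu (fs j) (gfs j)) /\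
    (forall j gamma x, 0 < gamma -> is_prox (fs j) gamma x (prx j gamma x)) /\
    (forall y, favg fs xstar <= favg fs y) /\
    favg fs (pifo_x0 A (S m)) - favg fs xstar = Delta /\
    (forall t, Delta / 2 * ((1 - 2 / INR n * (1 - r * r)) ^ t - (r * r) ^ m) <=
       expect (pifo_p A) t (fun s => favg fs (iterate A fs gfs prx s)) - favg fs xstar).
Proof.
  intros Hn Hm Hmu Hr HDelta Hratio HA.
  destruct (exists_two_unlikely n (pifo_p A) Hn (proj1 HA) (proj1 (proj2 HA)))
    as (a & b & Hab & Ha & Hb).
  destruct (exists_reflection_to_axis m r (pifo_x0 A (S m))) as (z & H & Hrefl & Hstart).
  destruct (exists_amplitude mu r Delta) as [B HB]; [lra..|].
  set (w := (L - mu) / 2) in *.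
  assert (Hw : 0 <= w).
  { assert (0 <= INR n * mu * r)
      by (pose proof (pos_INR n); apply Rmult_le_pos; [apply Rmult_le_pos|]; lra).
    apply (Rmult_le_reg_r ((1 - r) * (1 - r))); nra. }
  replace L with (mu + 2 * w) by (unfold w; field).
  exists (hard_fun m mu w r B z n a b H), (hard_grad m mu w r B z n a b H),
    (hard_prox m mu w r B z n a b H), (hard_min m r B z H).
  assert (Hr_lt1 : 0 <= r < 1) by lra.
  repeat (apply conj).
  - apply hard_is_gradient; assumption.
  - apply hard_L_smooth; assumption.
  - apply hard_strongly_convex; assumption.
  - apply hard_is_prox; assumption.
  - apply hard_min_spec; assumption.
  - apply hard_initial_gap; assumption.
  - apply hard_expected_gap_ge; assumption.
Qed.

(** * Choice of the parameters *)

Lemma sqrt_ratio_ge N kappa : 2 <= N -> N / 2 + 1 <= kappa -> 1 <= 2 * sqrt (kappa / N).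
Proof.
  intros HN Hkappa; pose proof (sqrt_pos (kappa / N)).
  assert (Hhalf : / 2 <= kappa / N).
  { apply (Rmult_le_reg_r N); [lra|]; unfold Rdiv; rewrite Rmult_assoc, Rinv_l; lra. }
  pose proof (sqrt_sqrt (kappa / N) ltac:(lra)); nra.
Qed.

(* [r = (Q - 1) / (Q + 1)] solves the quadratic equation, with [Q^2 = 1 + 2 (L / mu - 1) / N]. *)
Lemma exists_chain_ratio N L mu (s := sqrt (L / mu / N)) :
  2 <= N -> 0 < mu -> N / 2 + 1 <= L / mu ->
  exists r, / 6 <= r < 1 /\ (L - mu) / 2 * ((1 - r) * (1 - r)) = N * mu * r /\
    / (2 * s) <= 1 - r <= 2 / (1 + s).
Proof.
  intros HN Hmu; set (kappa := L / mu) in *; intros Hkappa.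
  pose proof (sqrt_ratio_ge N kappa HN Hkappa) as Hs; fold s in Hs.
  assert (Hs_sqr : s * s * N = kappa).
  { unfold s; rewrite sqrt_sqrt; [field; lra|].
    apply Rlt_le, Rdiv_lt_0_compat; lra. }
  set (Q := sqrt (1 + 2 * (kappa - 1) / N)).
  assert (HQ_sqr : Q * Q * N = N + 2 * (kappa - 1)).
  { unfold Q; rewrite sqrt_sqrt; [field; lra|].
    apply Rplus_le_le_0_compat; [lra|apply Rlt_le, Rdiv_lt_0_compat; lra]. }
  pose proof (sqrt_pos (1 + 2 * (kappa - 1) / N)) as HQ_ge0; fold Q in HQ_ge0.
  assert (HsQ : s <= Q <= 2 * s).
  { split; apply Rsqr_incr_0_var; try lra; unfold Rsqr; nra. }
  assert (HQ : 7 / 5 <= Q).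
  { apply Rsqr_incr_0_var; [unfold Rsqr; nra|lra]. }
  exists ((Q - 1) / (Q + 1)).
  assert (Hr : 1 - (Q - 1) / (Q + 1) = 2 / (Q + 1)) by (field; lra).
  assert (Hpos : 0 < 2 / (Q + 1)) by (apply Rdiv_lt_0_compat; lra).
  repeat split; rewrite ?Hr.
  - apply (Rmult_le_reg_r (Q + 1)); [lra|]; unfold Rdiv; rewrite Rmult_assoc, Rinv_l; lra.
  - lra.
  - replace (N * mu * ((Q - 1) / (Q + 1))) with (mu * (Q * Q * N - N) / ((Q + 1) * (Q + 1)))
      by (field; lra).
    rewrite HQ_sqr; unfold kappa; field; lra.
  - replace (2 / (Q + 1)) with (/ ((Q + 1) / 2)) by (field; lra).
    apply Rinv_le_contravar; lra.
  - apply Rmult_le_compat_l; [lra|apply Rinv_le_contravar; lra].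
Qed.

Lemma exists_chain_length r s Lam :
  0 <= r -> / (2 * s) <= 1 - r -> 1 <= 2 * s -> 1 <= Lam ->
  exists m, (1 <= m)%nat /\ INR (S m) <= 6 * s * Lam /\ (r * r) ^ m <= exp (- Lam).
Proof.
  intros Hr Hr_upper Hs HLam.
  destruct (exists_nat_ceil (2 * s * Lam)) as (m & Hm & Hlow & Hup); [nra|].
  exists m; split; [exact Hm|split; [rewrite S_INR; nra|]].
  eapply Rle_trans; [apply pow_le_exp; nra|apply exp_le, Ropp_le_contravar].
  assert (Hinv : 0 < / (2 * s)) by (apply Rinv_0_lt_compat; lra).
  apply Rle_trans with (2 * s * Lam * / (2 * s)); [right; field; lra|].
  apply Rmult_le_compat; nra.
Qed.

(* With [x = 2 / N * (1 - r * r)], one has [x <= 8 / (N * (1 + s))] and [/ (1 - x) <= 36],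
   whence the constant [576 = 2 * 8 * 36]. *)
Lemma decay_ge N s r Lam t :
  2 <= N -> 0 <= s -> / 6 <= r < 1 -> 1 - r <= 2 / (1 + s) -> 0 <= Lam ->
  INR t <= / 576 * (N + N * s) * Lam ->
  exp (- (Lam / 2)) <= (1 - 2 / N * (1 - r * r)) ^ t.
Proof.
  intros HN Hs Hr Hr_lower HLam Ht; set (x := 2 / N * (1 - r * r)).
  pose proof (two_div_bounds N HN) as HtwoN.
  assert (Hrr : 0 <= 1 - r * r <= 35 / 36) by nra.
  assert (Hx : 0 <= x <= 35 / 36) by (unfold x; generalize dependent (2 / N); intros; nra).
  assert (Hx_rate : x <= 8 / (N * (1 + s))).
  { replace (8 / (N * (1 + s))) with (2 / N * (2 * (2 / (1 + s)))) by (field; lra).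
    apply Rmult_le_compat_l; nra. }
  eapply Rle_trans; [|apply pow_ge_exp; lra].
  apply exp_le, Ropp_le_contravar.
  assert (Hdiv : 0 <= x / (1 - x) <= 36 * x).
  { split; [apply Rmult_le_pos; [|left; apply Rinv_0_lt_compat]; lra|].
    apply (Rmult_le_reg_r (1 - x)); [lra|]; unfold Rdiv; rewrite Rmult_assoc, Rinv_l; nra. }
  apply Rle_trans with (/ 576 * (N + N * s) * Lam * (36 * (8 / (N * (1 + s))))).
  - apply Rmult_le_compat; [apply pos_INR|lra|exact Ht|lra].
  - right; field; lra.
Qed.

Lemma exp_opp_ln_div x y : 0 < x -> 0 < y -> exp (- ln (x / y)) = y / x.
Proof.
  intros Hx Hy; rewrite exp_Ropp, exp_ln by (apply Rdiv_lt_0_compat; assumption); field; lra.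
Qed.

Lemma ln_div_ge_1 x y : 0 < x -> 0 < y -> y / x <= / 3 -> 1 <= ln (x / y).
Proof.
  intros Hx Hy Hyx; apply Rnot_lt_le; intros Hlt.
  apply Ropp_lt_contravar, exp_increasing in Hlt.
  rewrite exp_opp_ln_div, exp_Ropp in Hlt by assumption.
  pose proof (Rinv_le_contravar _ _ (exp_pos 1) exp_le_3); lra.
Qed.

Lemma half_decay_difference_ge Delta eps p q : 0 < Delta -> 0 < eps -> eps / Delta <= / 9 ->
  exp (- (ln (Delta / eps) / 2)) <= p -> q <= exp (- ln (Delta / eps)) ->
  eps <= Delta / 2 * (p - q).
Proof.
  intros HDelta Heps Hratio Hp Hq; set (Lam := ln (Delta / eps)) in *.
  assert (Hexp : exp (- Lam) = eps / Delta) by (apply exp_opp_ln_div; assumption).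
  assert (Hsq : exp (- Lam) = exp (- (Lam / 2)) * exp (- (Lam / 2)))
    by (rewrite <- exp_plus; f_equal; field).
  pose proof (exp_pos (- (Lam / 2))).
  assert (exp (- (Lam / 2)) <= / 3) by nra.
  replace eps with (Delta / 2 * (2 * exp (- Lam))) by (rewrite Hexp; field; lra).
  apply Rmult_le_compat_l; nra.
Qed.

Theorem theorem3p1 :
  exists c C : R, 0 < c /\ 0 < C /\
  forall (n : nat) (L mu Delta eps : R),
    (2 <= n)%nat -> 0 < L -> 0 < mu -> 0 < Delta -> 0 < eps ->
    L / mu >= INR n / 2 + 1 ->
    eps / Delta <= 327 / 100000 ->
    forall A : PIFO n, is_PIFO A ->
    exists (d : nat) (fs : Fin.t n -> Vec d -> R)
           (gfs : Fin.t n -> Vec d -> Vec d)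
           (prx : Fin.t n -> R -> Vec d -> Vec d) (xstar : Vec d),
      INR d <= C * sqrt ((L / mu) / INR n) * ln (Delta / eps) /\
      (forall j, is_gradient (fs j) (gfs j)) /\
      (forall j, L_smooth L (gfs j)) /\
      (forall j, strongly_convex mu (fs j) (gfs j)) /\
      (forall j gamma x, 0 < gamma -> is_prox (fs j) gamma x (prx j gamma x)) /\
      (forall y, favg fs xstar <= favg fs y) /\
      favg fs (pifo_x0 A d) - favg fs xstar = Delta /\
      (forall t : nat,
         INR t <= c * (INR n + sqrt ((L / mu) * INR n)) * ln (Delta / eps) ->
         expect (pifo_p A) t (fun s => favg fs (iterate A fs gfs prx s))
           - favg fs xstar >= eps).
Proof.
  exists (/ 576), 6; split; [lra|]; split; [lra|].
  intros n L mu Delta eps Hn HL Hmu HDelta Heps Hkappa Hratio A HA.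
  assert (HN : 2 <= INR n) by (apply (le_INR 2), Hn).
  assert (Hs : 1 <= 2 * sqrt (L / mu / INR n)) by (apply sqrt_ratio_ge; lra).
  assert (HLam : 1 <= ln (Delta / eps)) by (apply ln_div_ge_1; lra).
  destruct (exists_chain_ratio (INR n) L mu HN Hmu) as (r & Hr & Heq & Hr_upper & Hr_lower); [lra|].
  destruct (exists_chain_length r _ _ ltac:(lra) Hr_upper Hs HLam) as (m & Hm & Hdim & Htail).
  destruct (hard_instance n m L mu r Delta A)
    as (fs & gfs & prx & xstar & Hgrad & Hsmooth & Hsc & Hprox & Hmin & Hgap & Hrun);
    [assumption || lra ..|].
  exists (S m), fs, gfs, prx, xstar; do 7 (split; [assumption|]).
  intros t Ht; rewrite sqrt_mult_div in Ht by lra.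
  apply Rle_ge, Rle_trans with (2 := Hrun t).
  apply half_decay_difference_ge; [lra..| |exact Htail].
  apply decay_ge with (sqrt (L / mu / INR n)); assumption || apply sqrt_pos || lra.
Qed.
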